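(* If $T$ is a tree with $|V(T)|\ge 3$, then $\Psi(L(T)) = \sigma(T) - ex'(T)$, where $\sigma(T)$ is the number of leaves of $T$ and $ex'(T)$ is the number of strong exterior major vertices of $T$.
   Context: A leaf of a tree is a vertex of degree 1; a major vertex is a vertex of degree at least 3; a strong exterior major vertex is a major vertex adjacent to at least one leaf. For a connected graph $H$ with distance $d_H$, a pair $\{x,y\}$ of vertices doubly resolves a pair $\{u,v\}$ if $d_H(u,x)-d_H(u,y)\neq d_H(v,x)-d_H(v,y)$; a set $S\subseteq V(H)$ is a doubly resolving set if every pair of distinct vertices of $H$ is doubly resolved by some pair of vertices of $S$, and $\Psi(H)$ is the minimum size of such a set. $L(T)$ is the line graph of $T$ (vertices are the edges of $T$, adjacent iff they share an end vertex). *)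

(* Defs.v *)
From HB Require Import structures.
From mathcomp Require Import all_boot all_order all_algebra.

Set Implicit Arguments.
Unset Strict Implicit.
Unset Printing Implicit Defensive.

Import Order.TTheory GRing.Theory Num.Theory.

Record sgraph := SGraph {
  vertex :> finType;
  adj : rel vertex;
  adj_sym : symmetric adj;
  adj_irr : irreflexive adj }.

Definition walk (G : sgraph) (n : nat) (x y : G) : bool :=
  [exists p : n.-tuple G, path (@adj G) x p && (last x p == y)].

(* Least length of a walk from x to y; a shortest walk visits no vertex twice,
   hence has length < #|G|.  The junk value #|G| is taken exactly when y cannot
   be reached from x. *)
Definition dist (G : sgraph) (x y : G) : nat :=
  find (fun n => walk n x y) (iota 0 #|G|).

Definition connected_graph (G : sgraph) : Prop :=
  (0 < #|G|) /\ forall x y : G, connect (@adj G) x y.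

Definition acyclic_graph (G : sgraph) : Prop :=
  forall c : seq G, 2 < size c -> ~ ucycle (@adj G) c.

Definition is_tree (G : sgraph) : Prop := connected_graph G /\ acyclic_graph G.

Definition degree (G : sgraph) (x : G) : nat := #|[set y | adj x y]|.

Definition is_leaf (G : sgraph) (x : G) : bool := degree x == 1.

Definition is_major (G : sgraph) (x : G) : bool := 3 <= degree x.

Definition is_strong_exterior_major (G : sgraph) (x : G) : bool :=
  is_major x && [exists y : G, adj x y && is_leaf y].

Definition num_leaves (G : sgraph) : nat := #|[set x : G | is_leaf x]|.

Definition num_strong_exterior_major (G : sgraph) : nat :=
  #|[set x : G | is_strong_exterior_major x]|.

Definition is_edge (G : sgraph) (A : {set G}) : bool :=
  [exists x : G, exists y : G, adj x y && (A == [set x; y])].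

Definition edge (G : sgraph) : finType := {A : {set G} | is_edge A}.

Definition edge_adj (G : sgraph) : rel (edge G) :=
  fun a b => (a != b) && (val a :&: val b != set0).

Lemma edge_adj_sym (G : sgraph) : symmetric (@edge_adj G).
Proof. by move=> a b; rewrite /edge_adj eq_sym setIC. Qed.

Lemma edge_adj_irr (G : sgraph) : irreflexive (@edge_adj G).
Proof. by move=> a; rewrite /edge_adj eqxx. Qed.

Definition line_graph (G : sgraph) : sgraph :=
  SGraph (@edge_adj_sym G) (@edge_adj_irr G).

Definition doubly_resolves (H : sgraph) (x y u v : H) : bool :=
  ((dist u x)%:Z - (dist u y)%:Z != (dist v x)%:Z - (dist v y)%:Z)%R.

Definition doubly_resolving (H : sgraph) (S : {set H}) : bool :=
  [forall u : H, forall v : H, (u != v) ==>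
    [exists x in S, exists y in S, doubly_resolves x y u v]].

(* The default argument [set: H] of arg min is harmless: it is doubly resolving
   when H is connected (doubly_resolving_setT), and Psi is then the minimum
   (Psi_attained, Psi_min). *)
Definition Psi (H : sgraph) : nat :=
  #|[arg min_(S < [set: H] | doubly_resolving S) #|S|]|.

Lemma walkP (G : sgraph) (n : nat) (x y : G) :
  reflect (exists p : seq G, [/\ size p = n, path (@adj G) x p & last x p = y])
          (walk n x y).
Proof.
apply: (iffP existsP) => [[p /andP[Hp /eqP Hl]]|[p [Hs Hp Hl]]].
  by exists p; rewrite size_tuple.
by exists (tcast Hs (in_tuple p)); rewrite val_tcast Hp Hl eqxx.
Qed.

Lemma walk_sym (G : sgraph) (n : nat) (x y : G) : walk n x y = walk n y x.
Proof.
suff imp : forall u v : G, walk n u v -> walk n v u by apply/idP/idP; apply: imp.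
move=> u v; case/walkP=> p [Hs Hp Hl]; apply/walkP; exists (rev (belast u p)); split.
- by rewrite size_rev size_belast.
- rewrite -Hl rev_path.
  by rewrite (eq_path (e' := @adj G)) // => a b; rewrite adj_sym.
- by case: p Hl {Hs Hp} => [|a p] /= Hl; rewrite ?rev_cons ?last_rcons.
Qed.

Lemma dist_sym (G : sgraph) (x y : G) : dist x y = dist y x.
Proof. by apply: eq_find => n; rewrite walk_sym. Qed.

Lemma dist_le (G : sgraph) (n : nat) (x y : G) : walk n x y -> dist x y <= n.
Proof.
move=> w; rewrite leqNgt; apply/negP => lt_n.
have lt_nG : n < #|G|.
  by apply: leq_trans lt_n _; rewrite /dist -[leqRHS](size_iota 0) find_size.
by have := before_find 0 lt_n; rewrite nth_iota // add0n w.
Qed.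

Lemma dist_walk (G : sgraph) (x y : G) :
  connect (@adj G) x y -> walk (dist x y) x y.
Proof.
case/connectP=> p0 Hp0 Hy; case/shortenP: Hp0 Hy => p Hp Up _ ->.
have lt_pG : size p < #|G| by have := max_card (mem (x :: p)); rewrite (card_uniqP Up).
have Hhas : has (fun n => walk n x (last x p)) (iota 0 #|G|).
  apply/hasP; exists (size p); first by rewrite mem_iota add0n.
  by apply/walkP; exists p.
have := nth_find 0 Hhas; rewrite nth_iota ?add0n //.
by rewrite -[ltnRHS](size_iota 0) -has_find.
Qed.

Lemma dist_eq0 (G : sgraph) (x y : G) :
  connect (@adj G) x y -> (dist x y == 0) = (x == y).
Proof.
move=> cxy; apply/eqP/eqP => [d0 | ->].
  by have := dist_walk cxy; rewrite d0 => /walkP[p [/size0nil-> _ /= ->]].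
by apply/eqP; rewrite -leqn0; apply: dist_le; apply/walkP; exists [::].
Qed.

Lemma doubly_resolving_setT (H : sgraph) :
  connected_graph H -> doubly_resolving [set: H].
Proof.
move=> [_ cH]; apply/forallP=> u; apply/forallP=> v; apply/implyP=> neq_uv.
apply/existsP; exists u; rewrite inE /=; apply/existsP; exists v; rewrite inE /=.
rewrite /doubly_resolves (dist_sym v u).
have /eqP-> : dist u u == 0 by rewrite dist_eq0.
have /eqP-> : dist v v == 0 by rewrite dist_eq0.
rewrite subr0 sub0r.
have : 0 < dist u v by rewrite lt0n dist_eq0.
by case: (dist u v).
Qed.

Lemma Psi_attained (H : sgraph) : connected_graph H ->
  exists2 S : {set H}, doubly_resolving S & #|S| = Psi H.
Proof.
move=> cH; rewrite /Psi; case: arg_minnP => [|S HS _].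
  exact: doubly_resolving_setT.
by exists S.
Qed.

Lemma Psi_min (H : sgraph) (S : {set H}) :
  connected_graph H -> doubly_resolving S -> Psi H <= #|S|.
Proof.
move=> cH HS; rewrite /Psi; case: arg_minnP => [|S0 _]; last exact.
exact: doubly_resolving_setT.
Qed.

(* Main.v *)
Require Import Defs.
From mathcomp Require Import all_boot all_order all_algebra.
From mathcomp Require Import zify.

Import GRing.Theory.

(** For an edge [ab] of the tree, write [branch a b] for the set of edges that
meet the side of [a] in [T - ab]; then [ab] separates [branch a b] from the
other edges in the line graph.  The doubly resolving sets turn out to be those
sets that contain every pendant edge, except possibly one at each major vertex.

Such sets are necessary, because two pendant edges at the same vertex are twins
in the line graph, and because a pendant edge at a vertex of degree 2 has a
single neighbour in the line graph.  Conversely, if [S] has this property, then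
a branch misses [S] only if it is reduced to one pendant edge.  Given edges
[u <> v], a member of [S] in the branch behind [u] is closer to [u] than to [v];
if this branch misses [S], a third branch at the inner end of [u] contains a
member of [S] which is still strictly closer to [u], unless [v] shares that inner
end, in which case it may be equidistant.  Both [u] and [v] fall in this
exceptional case only if they are two missing pendant edges at one vertex. *)

(** * Distances in connected graphs *)

Lemma dist_triangle (G : sgraph) (x y z : G) :
  connected_graph G -> dist x z <= dist x y + dist y z.
Proof.
move=> [_ cG]; apply: dist_le; apply/walkP.
have /walkP[p [<- pp <-]] := dist_walk (cG x y).
have /walkP[q [<- pq <-]] := dist_walk (cG (last x p) z).
by exists (p ++ q); rewrite size_cat cat_path pp pq last_cat.
Qed.

Lemma dist_adj (G : sgraph) (x y : G) : adj x y -> dist x y <= 1.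
Proof. by move=> xy; apply: dist_le; apply/walkP; exists [:: y]; rewrite /= xy. Qed.

Lemma distxx (G : sgraph) (x : G) : dist x x = 0.
Proof. by apply/eqP; rewrite dist_eq0 ?connect0. Qed.

Lemma dist_gt0 (G : sgraph) (x y : G) :
  connected_graph G -> (0 < dist x y) = (x != y).
Proof. by move=> [_ cG]; rewrite lt0n dist_eq0. Qed.

Lemma dist1_adj (G : sgraph) (x y : G) :
  connected_graph G -> dist x y = 1 -> adj x y.
Proof.
move=> [_ cG] d1; have := dist_walk (cG x y); rewrite d1.
by case/walkP=> -[|z [|y' p]] [] //= _ /andP[xz _] <-.
Qed.

(** A walk from [x] to [y] has to leave [P], and it can do so only from [u]; hence a shortest walk
    passes through [u]. *)
Lemma dist_cut (G : sgraph) (P : pred G) (u x y : G) :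
    connected_graph G -> P x -> ~~ P y ->
    (forall z w, P z -> ~~ P w -> adj z w -> z = u) ->
  dist x y = dist x u + dist u y.
Proof.
move=> cG Px Py cutP; apply/eqP; rewrite eqn_leq dist_triangle //=.
have /walkP[p [<- pp lp]] := dist_walk (proj2 cG x y).
elim: p x Px pp lp => [|z p IHp] x Px /=.
  by move=> _ xy; rewrite -xy Px in Py.
case/andP=> xz pp lp; have [Pz|Pz] := boolP (P z).
  apply: leq_trans (_ : 1 + (dist z u + dist u y) <= _); last by rewrite add1n ltnS IHp.
  rewrite addnA leq_add2r; apply: leq_trans (dist_triangle _ x z u cG) _.
  by rewrite leq_add2r dist_adj.
rewrite -(cutP _ _ Px Pz xz) distxx add0n.
by apply: dist_le; apply/walkP; exists (z :: p); rewrite /= xz.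
Qed.

(** In a shortest walk from [f] to [x], which has a first step since [x != f], the start can be
    replaced by [e]; if the next vertex is [e] itself, the first step is dropped. *)
Lemma dist_twin_le (G : sgraph) (e f x : G) : connected_graph G ->
  (forall z, z != e -> adj f z -> adj e z) -> x != f -> dist e x <= dist f x.
Proof.
move=> cG twin xf; have /walkP[p [<- pp lp]] := dist_walk (proj2 cG f x).
case: p pp lp => [_ /= fx|z p /= /andP[fz pp] lp]; first by rewrite fx eqxx in xf.
have [ze|ze] := eqVneq z e.
  by apply: leqW; apply: dist_le; apply/walkP; exists p; rewrite -ze.
by apply: dist_le; apply/walkP; exists (z :: p); rewrite /= twin.
Qed.

(** * Edges, leaves and connectedness of the line graph *)

Lemma edge_exists (G : sgraph) (a b : G) :
  adj a b -> exists e : edge G, val e = [set a; b].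
Proof.
move=> ab; suff ie : is_edge [set a; b] by exists (exist (@is_edge G) _ ie).
by apply/existsP; exists a; apply/existsP; exists b; rewrite ab eqxx.
Qed.

Lemma edgeP (G : sgraph) (e : edge G) :
  exists a b : G, adj a b /\ val e = [set a; b].
Proof.
by have /existsP[a /existsP[b /andP[ab /eqP eab]]] := valP e; exists a, b.
Qed.

Lemma edge_other_end (G : sgraph) (e : edge G) (x : G) :
  x \in val e -> exists2 y : G, adj x y & val e = [set x; y].
Proof.
have [a [b [ab ->]]] := edgeP G e; rewrite !inE.
by case/orP=> /eqP->; [exists b | exists a; rewrite // ?(adj_sym b) // setUC].
Qed.

Lemma edge_pair (G : sgraph) (e : edge G) (x y : G) :
  x \in val e -> y \in val e -> x != y -> val e = [set x; y].
Proof.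
move=> xe; have [z _ ->] := edge_other_end _ _ _ xe.
by rewrite !inE => /orP[]/eqP->; rewrite ?eqxx.
Qed.

Lemma set2_inj (X : finType) (a b c : X) : [set a; b] = [set a; c] -> b = c.
Proof.
move=> E; have := set22 a b; rewrite E !inE => /orP[]/eqP // ba.
by have := set22 a c; rewrite -E ba !inE orbb => /eqP->.
Qed.

Lemma edge_adjI (G : sgraph) (e f : edge G) (x : G) :
  e != f -> x \in val e -> x \in val f -> edge_adj e f.
Proof.
by move=> ef xe xf; rewrite /edge_adj ef; apply/set0Pn; exists x; rewrite inE xe.
Qed.

Lemma leaf_adj_inj (G : sgraph) (a b c : G) :
  is_leaf a -> adj a b -> adj a c -> b = c.
Proof.
case/cards1P=> d Ed ab ac.
have : b \in [set y | adj a y] by rewrite inE.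
have : c \in [set y | adj a y] by rewrite inE.
by rewrite Ed !inE => /eqP-> /eqP->.
Qed.

Lemma leaf_edge_inj (G : sgraph) (a : G) (e f : edge G) :
  is_leaf a -> a \in val e -> a \in val f -> e = f.
Proof.
move=> la /edge_other_end[b ab Ee] /edge_other_end[c ac Ef].
by apply: val_inj; rewrite Ee Ef (leaf_adj_inj _ _ _ _ la ab ac).
Qed.

Lemma nonleaf_adj (G : sgraph) (a b : G) :
  adj a b -> ~~ is_leaf a -> exists2 c, adj a c & c != b.
Proof.
move=> ab; rewrite /is_leaf /degree (cardsD1 b) inE ab eqSS.
by rewrite -lt0n => /card_gt0P[c]; rewrite !inE => /andP[cb ac]; exists c.
Qed.

Lemma major_adj2 (G : sgraph) (b a : G) : is_major b -> adj b a ->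
  exists c d, [/\ adj b c, adj b d, c != a, d != a & c != d].
Proof.
rewrite /is_major /degree (cardsD1 a) => mb ba; rewrite inE ba ltnS in mb.
have /card_gt1P[c [d]] := mb; rewrite !inE => -[/andP[ca bc] /andP[da bd] cd].
by exists c, d.
Qed.

Lemma connected_line_graph (G : sgraph) :
  connected_graph G -> 3 <= #|G| -> connected_graph (line_graph G).
Proof.
move=> [G0 cG] G3; split.
  have /card_gt1P[x [y [_ _ xy]]] := ltnW G3.
  have /connectP[[|z p] /=] := cG x y; first by move=> _ yx; rewrite yx eqxx in xy.
  by case/andP=> /edge_exists[e _] _ _; apply/card_gt0P; exists e.
move=> e f; have [x [x' [_ Ee]]] := edgeP G e; have [y [y' [_ Ef]]] := edgeP G f.
have xe : x \in val e by rewrite Ee set21.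
have yf : y \in val f by rewrite Ef set21.
have /connectP[p pp lp] := cG x y.
elim: p x e xe pp lp {x' Ee} => [|z p IHp] x e xe /=.
  move=> _ yx; have [-> //|ef] := eqVneq e f.
  by apply: connect1; apply: edge_adjI ef xe _; rewrite -yx.
case/andP=> /edge_exists[g Eg] pp lp.
apply: connect_trans (IHp z g _ pp lp); last by rewrite Eg set22.
have [-> //|eg] := eqVneq e g.
by apply: connect1; apply: edge_adjI eg xe _; rewrite Eg set21.
Qed.

(** * Branches behind an edge of the tree *)

Definition del_adj {G : sgraph} (a b : G) : rel G :=
  fun x y => adj x y && ([set x; y] != [set a; b]).

(** The edge [ab] meets both sides, so it belongs to [branch a b] and to [branch b a]; by
    [branch_both] it is the only such edge in a tree. *)
Definition branch {G : sgraph} (a b : G) : {set edge G} :=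
  [set e : edge G | [exists x in val e, connect (del_adj a b) a x]].

Lemma branchP {G : sgraph} {a b : G} {e : edge G} :
  reflect (exists2 x, x \in val e & connect (del_adj a b) a x) (e \in branch a b).
Proof. by rewrite inE; apply: exists_inP. Qed.

Lemma branch_end (G : sgraph) (a b : G) (e : edge G) :
  a \in val e -> e \in branch a b.
Proof. by move=> ae; apply/branchP; exists a. Qed.

Lemma del_adjC (G : sgraph) (a b : G) : del_adj a b = del_adj b a.
Proof. by rewrite /del_adj setUC. Qed.

Lemma del_connect_sym (G : sgraph) (a b : G) : connect_sym (del_adj a b).
Proof.
by apply: sym_connect_sym => x y; rewrite /del_adj adj_sym [[set y; x]]setUC.
Qed.

Lemma del_adj_edge (G : sgraph) (a b x y : G) (e : edge G) :
    val e != [set a; b] -> x \in val e -> y \in val e ->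
  connect (del_adj a b) x y.
Proof.
move=> eab xe ye; have [-> //|xy] := eqVneq x y.
have [z xz Ez] := edge_other_end _ _ _ xe.
have Exy := edge_pair _ _ _ _ xe ye xy.
rewrite -(set2_inj _ _ _ _ (etrans (esym Ez) Exy)).
by apply: connect1; rewrite /del_adj xz -Ez.
Qed.

(** An edge other than [ab] has both ends on one side of the cut, so every edge that touches it
    meets that side too. *)
Lemma branch_cut (G : sgraph) (a b : G) (e f : edge G) :
    e \in branch a b -> f \notin branch a b -> edge_adj e f ->
  val e = [set a; b].
Proof.
case/branchP=> x xe ax /negP nf /andP[_ /set0Pn[z]]; rewrite inE => /andP[ze zf].
apply/eqP/negPn/negP => eab; case: nf; apply/branchP; exists z => //.
by apply: connect_trans ax (del_adj_edge _ _ _ _ _ _ eab xe ze).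
Qed.

Lemma dist_branch (G : sgraph) (a b : G) (u x v : line_graph G) :
    connected_graph (line_graph G) -> val u = [set a; b] ->
    x \in branch a b -> v \notin branch a b ->
  dist v x = dist v u + dist u x.
Proof.
move=> cL Eu xb vb; rewrite [dist v x]dist_sym [dist v u]dist_sym.
rewrite [dist u x]dist_sym addnC.
apply: (dist_cut (line_graph G) (fun e => e \in branch a b)) => // z w zb wb zw.
by apply: val_inj; rewrite (branch_cut _ _ _ _ _ zb wb zw) Eu.
Qed.

(** A path from [a] to [b] that avoids the edge [ab] has at least two edges, and [ab] closes it into
    a cycle. *)
Lemma tree_bridge (T : sgraph) (a b : T) :
  is_tree T -> adj a b -> ~ connect (del_adj a b) a b.
Proof.
move=> [_ acT] ab /connectP[p pp]; case/shortenP: pp => q qq uq _ lq.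
apply: (acT (a :: q)).
  case: q qq {uq} lq => [_ /= lq|c [|//] /=]; first by rewrite lq adj_irr in ab.
  by rewrite andbT => /[swap] <-; rewrite /del_adj eqxx andbF.
rewrite /ucycle uq andbT /= rcons_path -lq [adj b a]adj_sym ab andbT.
by apply: sub_path qq => x y /andP[].
Qed.

Lemma branch_both (T : sgraph) (a b : T) (v : edge T) :
  is_tree T -> adj a b -> v \in branch a b -> v \in branch b a ->
  val v = [set a; b].
Proof.
move=> hT ab /branchP[x xv ax] /branchP[y yv by_].
apply/eqP/negPn/negP => vab; apply: (tree_bridge _ _ _ hT ab).
apply: connect_trans ax _.
apply: connect_trans (del_adj_edge _ _ _ _ _ _ vab xv yv) _.
by rewrite del_connect_sym del_adjC.
Qed.

(** A walk from [w] that avoids the edge [wa] never reaches [a], hence never uses [ab]; the step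
    from [a] to [w] is put in front of it. *)
Lemma side_sub (T : sgraph) (w a b x : T) :
    is_tree T -> adj a w -> w != b ->
  connect (del_adj w a) w x -> connect (del_adj a b) a x.
Proof.
move=> hT aw wb /connectP[p pp ->].
have nwa : ~~ connect (del_adj w a) w a.
  by apply/negP; apply: tree_bridge; rewrite // adj_sym.
have cw : connect (del_adj a b) a w.
  apply: connect1; rewrite /del_adj aw; apply: contra wb => /eqP/set2_inj->.
  exact: eqxx.
suff gen y : connect (del_adj a b) a y -> connect (del_adj w a) w y ->
    path (del_adj w a) y p -> connect (del_adj a b) a (last y p).
  exact: gen.
elim: p y {pp} => [|z p IHp] y //= cy wy /andP[yz pp].
have wz := connect_trans wy (connect1 yz).
suff yz' : del_adj a b y z by apply: IHp (connect_trans cy (connect1 yz')) wz pp.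
have /andP[ayz _] := yz; rewrite /del_adj ayz /=.
apply/negP => /eqP E; have : a \in [set y; z] by rewrite E set21.
by rewrite !inE => /orP[]/eqP Ea; case/negP: nwa; rewrite {2}Ea.
Qed.

Lemma branch_sub (T : sgraph) (w a b : T) :
  is_tree T -> adj a w -> w != b -> branch w a \subset branch a b.
Proof.
move=> hT aw wb; apply/subsetP => e /branchP[x xe wx]; apply/branchP.
by exists x => //; apply: side_sub wx.
Qed.

(** By [branch_sub], each of the two branches lies in the branch of [b] opposite to the other one,
    so a common member would be both the edge [bw] and the edge [bw']. *)
Lemma branch_disjoint (T : sgraph) (b w w' : T) (v : edge T) :
    is_tree T -> adj b w -> adj b w' -> w != w' ->
  v \in branch w b -> v \notin branch w' b.
Proof.
move=> hT bw bw' ww' vw; apply/negP => vw'.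
have E := branch_both _ _ _ _ hT bw (subsetP (branch_sub _ _ _ _ hT bw' _) _ vw') vw.
have E' := branch_both _ _ _ _ hT bw' (subsetP (branch_sub _ _ _ _ hT bw ww') _ vw) vw'.
rewrite E ?[w' == w]eq_sym // in E'.
by move/set2_inj: E' => E'; rewrite E' eqxx in ww'.
Qed.

Lemma orient_edge (T : sgraph) (u v : edge T) :
    is_tree T -> u != v ->
  exists a b, [/\ adj a b, val u = [set a; b] & v \notin branch a b].
Proof.
move=> hT uv; have [a [b [ab Eu]]] := edgeP T u.
have [va|va] := boolP (v \in branch a b); last by exists a, b.
exists b, a; rewrite adj_sym setUC; split=> //; apply/negP => vb.
case/eqP: uv; apply: val_inj.
by rewrite Eu (branch_both _ _ _ _ hT ab va vb).
Qed.

(** * Pendant covers are doubly resolving *)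

Definition pendant_cover {T : sgraph} (S : {set edge T}) : Prop :=
  (forall (a b : T) (e : edge T), adj a b -> is_leaf a ->
     val e = [set a; b] -> e \notin S -> is_major b) /\
  (forall (a a' b : T) (e e' : edge T), is_leaf a -> is_leaf a' ->
     adj a b -> adj a' b -> val e = [set a; b] -> val e' = [set a'; b] ->
     e \notin S -> e' \notin S -> a = a').

(** Induction on the size of the side of [a]. If [a] has a further neighbour [c] whose branch misses
    [S], then [ac] is a missing pendant edge, so [a] is major and has a third neighbour [f] besides
    [b] and [c]. The branch behind [f] meets [S], as [a] carries only one missing pendant edge. *)
Lemma branch_meets (T : sgraph) (S : {set edge T}) (a b : T) (u : edge T) :
    is_tree T -> pendant_cover S -> adj a b -> val u = [set a; b] ->
  (exists2 x, x \in branch a b & x \in S) \/ (is_leaf a /\ u \notin S).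
Proof.
move=> hT [S1 S2].
have [n] := ubnP #|[set x | connect (del_adj a b) a x]|.
elim: n a b u => // n IHn a b u; rewrite ltnS => an ab Eu.
have [uS|uS] := boolP (u \in S).
  by left; exists u; rewrite // branch_end // Eu set21.
have [la|la] := boolP (is_leaf a); first by right.
left.
have IH w g : adj a w -> w != b -> val g = [set w; a] ->
    (exists2 x, x \in branch a b & x \in S) \/ (is_leaf w /\ g \notin S).
  move=> aw wb Eg; have sub := branch_sub _ _ _ _ hT aw wb.
  have wa : adj w a by rewrite adj_sym.
  have lt_n : #|[set x | connect (del_adj w a) w x]| < n.
    apply: leq_trans an; apply: proper_card; apply/properP; split.
      by apply/subsetP => x; rewrite !inE; apply: side_sub.
    by exists a; rewrite !inE //; apply/negP/tree_bridge.
  have [[x xw xS]|?] := IHn w a g lt_n wa Eg; last by right.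
  by left; exists x => //; apply: (subsetP sub).
have [c ac cb] := nonleaf_adj _ _ _ ab la.
have ca : adj c a by rewrite adj_sym.
have [g Eg] := edge_exists _ _ _ ca.
have [//|[lc gS]] := IH c g ac cb Eg.
have ma := S1 c a g ca lc Eg gS.
have [d [d' [ad ad' dc d'c dd']]] := major_adj2 _ _ _ ma ac.
have [f [af fc fb]] : exists f, [/\ adj a f, f != c & f != b].
  have [db|db] := eqVneq d b; last by exists d.
  by exists d'; split=> //; rewrite -db eq_sym.
have fa : adj f a by rewrite adj_sym.
have [h Eh] := edge_exists _ _ _ fa.
have [//|[lf hS]] := IH f h af fb Eh.
by case/eqP: fc; apply: (S2 f c a h g).
Qed.

(** Applied to [u], [v] and to [v], [u], this gives two members of [S], which doubly resolve the
    pair as soon as one of the two inequalities is strict. *)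
Lemma resolving_half (T : sgraph) (S : {set edge T}) (u v : line_graph T) :
    is_tree T -> connected_graph (line_graph T) -> pendant_cover S -> u != v ->
  exists2 x : line_graph T, x \in S &
    dist u x < dist v x \/
    dist u x = dist v x /\
      exists a b, [/\ adj a b, is_leaf a, val u = [set a; b], u \notin S
                    & b \in val v].
Proof.
move=> hT cL cS uv; have [a [b [ab Eu va]]] := orient_edge _ _ _ hT uv.
have [[x xa xS]|[la uS]] := branch_meets _ _ _ _ _ hT cS ab Eu.
  exists x => //; left; rewrite (dist_branch _ _ _ _ _ _ cL Eu xa va).
  by rewrite -[ltnLHS]add0n ltn_add2r dist_gt0 // eq_sym.
have mb := cS.1 _ _ _ ab la Eu uS; have ba : adj b a by rewrite adj_sym.
(* The major vertex [b] has two neighbours besides [a]; their branches are disjoint, so one of them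
   avoids [v]. *)
have [w [bw wa vw]] : exists w, [/\ adj b w, w != a & v \notin branch w b].
  have [c [d [bc bd ca da cd]]] := major_adj2 _ _ _ mb ba.
  have [vc|vc] := boolP (v \in branch c b); last by exists c.
  by exists d; split=> //; apply: branch_disjoint vc.
have wb : adj w b by rewrite adj_sym.
have [g Eg] := edge_exists _ _ _ wb.
have bu : b \in val u by rewrite Eu set22.
have uw : u \notin branch w b.
  apply/negP => uw; have E := branch_both _ _ _ _ hT bw (branch_end _ _ _ _ bu) uw.
  by rewrite Eu setUC in E; rewrite (set2_inj _ _ _ _ E) eqxx in wa.
(* If this branch missed [S], then [g] would be a second missing pendant edge at [b], besides
   [u]. *)
have [[x xw xS]|[lw gS]] := branch_meets _ _ _ _ _ hT cS wb Eg; last first.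
  by case/eqP: wa; apply: (cS.2 w a b g u).
have gw : g \in branch w b by rewrite branch_end // Eg set21.
exists x => //.
rewrite (dist_branch _ _ _ _ _ _ cL Eg xw vw) (dist_branch _ _ _ _ _ _ cL Eg xw uw).
have ug : dist (u : line_graph T) g <= 1.
  apply: dist_adj; apply: (edge_adjI _ _ _ b) => //; last by rewrite Eg set22.
  by apply: contraNneq uw => ->.
have vg : 0 < dist (v : line_graph T) g.
  by rewrite dist_gt0 //; apply: contraNneq vw => ->.
have [ltvg|levg] := ltnP 1 (dist v (g : line_graph T)).
  by left; rewrite ltn_add2r; apply: leq_ltn_trans ltvg.
have vg1 : dist v (g : line_graph T) = 1 by apply/eqP; rewrite eqn_leq levg.
have ug1 : dist u (g : line_graph T) = 1.
  apply/eqP; rewrite eqn_leq ug dist_gt0 //; by apply: contraNneq uw => ->.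
right; rewrite vg1 ug1; split=> //; exists a, b; split=> //.
(* [v] touches [g] at [b], since an end at [w] would put [v] into [branch w b]. *)
have /andP[_ /set0Pn[z]] := dist1_adj _ _ _ cL vg1.
rewrite !inE Eg !inE => /andP[zv /orP[]/eqP Ez]; last by rewrite -Ez.
by rewrite branch_end -?Ez in vw.
Qed.

Lemma pendant_cover_resolving (T : sgraph) (S : {set line_graph T}) :
    is_tree T -> connected_graph (line_graph T) -> pendant_cover S ->
  doubly_resolving S.
Proof.
move=> hT cL cS; apply/forallP => u; apply/forallP => v; apply/implyP => uv.
have [x xS Hx] := resolving_half _ _ _ _ hT cL cS uv.
have [|y yS Hy] := resolving_half _ _ v u hT cL cS; first by rewrite eq_sym.
apply/exists_inP; exists x => //; apply/exists_inP; exists y => //.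
rewrite /doubly_resolves.
have : dist u x < dist v x \/ dist v y < dist u y.
  case: Hx => [|[_ [a [b [ab la Eu uS bv]]]]]; first by left.
  case: Hy => [|[_ [c [d [cd lc Ev vS du]]]]]; first by right.
  have mb := cS.1 _ _ _ ab la Eu uS; have md := cS.1 _ _ _ cd lc Ev vS.
  (* The end [d] of [u] is major, so it is not the leaf [a]. Then [u] and [v] are missing pendant
     edges at the same vertex, hence equal. *)
  have Ebd : b = d.
    move: du; rewrite Eu !inE => /orP[]/eqP // Eda.
    by move: md; rewrite Eda /is_major (eqP la).
  case/eqP: uv; apply: val_inj; rewrite Eu Ev -Ebd; congr [set _; _].
  by apply: (cS.2 a c b u v); rewrite // ?Ebd.
by case: Hx => [|[? _]]; case: Hy => [|[? _]]; lia.
Qed.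

(** * Doubly resolving sets are pendant covers *)

(** The shift [k] cancels in differences of distances, so no pair from [S] would doubly resolve [u]
    and [v]. *)
Lemma doubly_resolving_neq (H : sgraph) (S : {set H}) (u v : H) (k : nat) :
    doubly_resolving S -> u != v ->
  ~ (forall x, x \in S -> dist u x = k + dist v x).
Proof.
move=> /forallP/(_ u)/forallP/(_ v)/implyP dS uv E.
have /exists_inP[x xS /exists_inP[y yS]] := dS uv.
by rewrite /doubly_resolves !E //; lia.
Qed.

(** Two adjacent leaves would form a whole connected component. *)
Lemma leaf_neighbor_nonleaf (T : sgraph) (a b : T) :
  connected_graph T -> 3 <= #|T| -> adj a b -> is_leaf a -> ~~ is_leaf b.
Proof.
move=> [_ cT] T3 ab la; apply/negP => lb.
have clos x : connect (@adj T) a x -> x \in [set a; b].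
  suff gen p y : y \in [set a; b] -> path (@adj T) y p -> last y p \in [set a; b].
    by case/connectP=> p pp ->; apply: gen pp; rewrite set21.
  elim: p y => //= z p IHp y yab /andP[yz pp]; apply: IHp pp.
  move: yab; rewrite !inE => /orP[]/eqP Ey; rewrite Ey in yz.
    by rewrite (leaf_adj_inj _ _ _ _ la yz ab) eqxx orbT.
  by rewrite (leaf_adj_inj _ _ _ _ lb yz (_ : adj b a)) ?eqxx // adj_sym.
have : #|T| <= #|[set a; b]|.
  by rewrite -cardsT; apply/subset_leq_card/subsetP => x _; apply: clos.
by rewrite leqNgt (leq_trans _ T3) // ltnS cards2; case: (a != b).
Qed.

Lemma resolving_pendant_cover (T : sgraph) (S : {set line_graph T}) :
    is_tree T -> 3 <= #|T| -> doubly_resolving S -> pendant_cover S.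
Proof.
move=> hT T3 dS; have cL := connected_line_graph _ hT.1 T3; split.
  move=> a b e ab la Ee eS; have ba : adj b a by rewrite adj_sym.
  have lb := leaf_neighbor_nonleaf _ _ _ hT.1 T3 ab la.
  rewrite /is_major ltnNge; apply/negP => db.
  have [c bc ca] := nonleaf_adj _ _ _ ba lb.
  (* If [b] is not major, its degree is 2, and the edge [f] from [b] to [c] is the only neighbour of
     [e] in the line graph. Every walk from outside to [e] then enters through [f], and the shift is
     [dist e f]. *)
  have bE z : adj b z -> z != a -> z = c.
    move=> bz za; apply/eqP/negPn/negP => zc.
    suff : 2 < degree b by rewrite ltnNge db.
    rewrite /degree (cardsD1 a) inE ba ltnS; apply/card_gt1P.
    by exists z, c; rewrite !inE za bz ca bc.
  have [f Ef] := edge_exists _ _ _ bc.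
  have ef : e != f.
    apply: contraNneq ca => E; apply/eqP; apply: esym; apply: (set2_inj _ b).
    by rewrite -Ef -E Ee setUC.
  apply: (doubly_resolving_neq (line_graph T) S e f (dist (e : line_graph T) f) dS ef).
  move=> x xS; rewrite dist_sym addnC (@dist_sym (line_graph T) f).
  rewrite (@dist_sym (line_graph T) e).
  apply: (dist_cut (line_graph T) (predC1 e)) => //=; rewrite ?eqxx //.
    by apply: contraNneq eS => <-.
  move=> z w /= ze; rewrite negbK => /eqP-> /andP[_ /set0Pn[y]].
  rewrite inE Ee !inE => /andP[yz /orP[]/eqP Ey].
    by case/eqP: ze; apply: (leaf_edge_inj _ a) => //; rewrite -?Ey // Ee Ey set21.
  rewrite Ey in yz; have [t bt Ez] := edge_other_end _ _ _ yz.
  apply: val_inj; rewrite Ez Ef (bE t) //; apply: contraNneq ze => Et.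
  by apply/eqP; apply: val_inj; rewrite Ez Et Ee setUC.
move=> a a' b e e' la la' ab a'b Ee Ee' eS e'S; apply/eqP/negPn/negP => aa'.
(* All neighbours of a pendant edge at [b] contain [b], so they touch every other edge at [b]. Two
   missing pendant edges are thus twins, with shift 0. *)
have nE (f f' : edge T) (c : T) : is_leaf c -> val f = [set c; b] -> b \in val f' ->
    forall z : line_graph T, z != f' -> edge_adj f z -> edge_adj f' z.
  move=> lc Ef bf' z zf' /andP[fz /set0Pn[y]]; rewrite inE Ef !inE.
  case/andP=> /orP[]/eqP Ey yz; rewrite Ey in yz.
    by case/eqP: fz; apply: (leaf_edge_inj _ c); rewrite // Ef set21.
  by apply: edge_adjI bf' yz; rewrite eq_sym.
have ee' : e != e'.
  apply: contraNneq aa' => E; apply/eqP; apply: (set2_inj _ b).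
  by rewrite setUC -Ee E Ee' setUC.
apply: (doubly_resolving_neq (line_graph T) S e e' 0 dS ee').
move=> x xS; apply/eqP; rewrite add0n eqn_leq; apply/andP; split.
  apply: dist_twin_le => //; last by apply: contraNneq e'S => <-.
  by apply: (nE e' e a') => //; rewrite Ee set22.
apply: dist_twin_le => //; last by apply: contraNneq eS => <-.
by apply: (nE e e' a) => //; rewrite Ee' set22.
Qed.

(** * Counting leaves against pendant covers *)

(* The closed neighbourhood of a leaf is the vertex set of its pendant edge; this
avoids picking edges when counting. *)
Definition closed_nbhd {G : sgraph} (a : G) : {set G} := a |: [set y | adj a y].

Lemma val_leaf_edge (G : sgraph) (a : G) (e : edge G) :
  is_leaf a -> a \in val e -> val e = closed_nbhd a.
Proof.
move=> la ae; have [b ab ->] := edge_other_end _ _ _ ae; rewrite /closed_nbhd.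
have /cards1P[d Ed] := la; rewrite Ed; have : b \in [set y | adj a y] by rewrite inE.
by rewrite Ed inE => /eqP->.
Qed.

Lemma leaf_edge_exists (G : sgraph) (a : G) :
  is_leaf a -> exists (b : G) (e : edge G), adj a b /\ val e = [set a; b].
Proof.
case/cards1P=> b Eb; have : b \in [set y | adj a y] by rewrite Eb set11.
by rewrite inE => ab; have [e Ee] := edge_exists _ _ _ ab; exists b, e.
Qed.

(** The leaves in [A], those on an edge of [S], inject into [S] by their pendant edges, as no edge
    joins two leaves. The other leaves inject into the strong exterior major vertices by their
    neighbours. *)
Lemma num_leaves_le (T : sgraph) (S : {set edge T}) :
    is_tree T -> 3 <= #|T| -> pendant_cover S ->
  num_leaves T <= #|S| + num_strong_exterior_major T.
Proof.
move=> hT T3 [S1 S2]; pose A := [set a : T | [exists e in S, a \in val e]].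
rewrite /num_leaves -(cardsID A) leq_add //.
  rewrite -(card_imset _ val_inj) -(card_in_imset (f := closed_nbhd)).
    apply/subset_leq_card/subsetP => _ /imsetP[a + ->]; rewrite !inE.
    case/andP=> la /exists_inP[e eS ae]; apply/imsetP; exists e => //.
    by rewrite (val_leaf_edge _ _ _ la ae).
  move=> a a'; rewrite !inE => /andP[la _] /andP[la' _] E.
  have : a \in closed_nbhd a' by rewrite -E !inE eqxx.
  rewrite !inE => /orP[/eqP //|a'a].
  by have := leaf_neighbor_nonleaf _ _ _ hT.1 T3 a'a la'; rewrite la.
(* The default [a] is taken only at isolated vertices, never at a leaf. *)
pose nb (a : T) := odflt a [pick y | adj a y].
have nbE a b : is_leaf a -> adj a b -> nb a = b.
  rewrite /nb => la ab; case: pickP => [c ac|/(_ b)]; last by rewrite ab.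
  exact: leaf_adj_inj ac ab.
have outS a b e : a \notin A -> val e = [set a; b] -> e \notin S.
  move=> aA Ee; apply: contra aA => eS; rewrite inE; apply/exists_inP; exists e => //.
  by rewrite Ee set21.
have inD a : (a \in [set a | is_leaf a] :\: A) = (a \notin A) && is_leaf a.
  by rewrite in_setD [X in _ && X]inE.
rewrite -(card_in_imset (f := nb)).
  apply/subset_leq_card/subsetP => _ /imsetP[a + ->]; rewrite inD.
  case/andP=> aA la; have [b [e [ab Ee]]] := leaf_edge_exists _ _ la.
  rewrite (nbE a b) // inE /is_strong_exterior_major.
  rewrite (S1 _ _ _ ab la Ee (outS _ _ _ aA Ee)); apply/existsP; exists a.
  by rewrite adj_sym ab.
move=> a a'; rewrite inD => /andP[aA la].
rewrite inD => /andP[aA' la'].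
have [b [e [ab Ee]]] := leaf_edge_exists _ _ la.
have [b' [e' [ab' Ee']]] := leaf_edge_exists _ _ la'.
rewrite (nbE a b) // (nbE a' b') // => Eb; rewrite -Eb in ab' Ee'.
exact: S2 la la' ab ab' Ee Ee' (outS _ _ _ aA Ee) (outS _ _ _ aA' Ee').
Qed.

(** One leaf [rep b] is chosen at each strong exterior major vertex [b], and [S] consists of the
    pendant edges of all other leaves. *)
Lemma pendant_cover_exists (T : sgraph) : exists2 S : {set edge T},
  pendant_cover S & #|S| + num_strong_exterior_major T <= num_leaves T.
Proof.
pose rep (b : T) := odflt b [pick a | adj b a && is_leaf a].
have repP b : is_strong_exterior_major b -> adj b (rep b) /\ is_leaf (rep b).
  case/andP=> _ /existsP[a ba]; rewrite /rep.
  by case: pickP => [c /andP[]|/(_ a)] //; rewrite ba.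
pose M := rep @: [set b | is_strong_exterior_major b].
pose L := [set a : T | is_leaf a].
(* [rep] is injective on these vertices because a leaf has a single neighbour. *)
have cardM : #|M| = num_strong_exterior_major T.
  apply: card_in_imset => b b'; rewrite !inE => /repP[br lb] /repP[br' _] E.
  by apply: (leaf_adj_inj _ _ _ _ lb); rewrite adj_sym // E.
have sML : M \subset L.
  by apply/subsetP => _ /imsetP[b + ->]; rewrite !inE => /repP[].
pose S := [set e : edge T | [exists a in val e, a \in L :\: M]].
have missS (a b : T) (e : edge T) : adj a b -> is_leaf a -> val e = [set a; b] ->
    e \notin S -> is_major b /\ a = rep b.
  move=> ab la Ee eS; have : a \in M.
    apply: contraR eS => aM; rewrite inE; apply/exists_inP; exists a.
      by rewrite Ee set21.
    by rewrite inE aM inE.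
  case/imsetP=> b' + Ea; rewrite inE => sb'; have [br _] := repP _ sb'.
  have <- : b' = b by apply: (leaf_adj_inj _ _ _ _ la); rewrite // adj_sym Ea.
  by case/andP: sb'.
exists S.
  split=> [a b e ab la Ee eS|a a' b e e' la la' ab ab' Ee Ee' eS eS'].
    by have [] := missS _ _ _ ab la Ee eS.
  have [_ ->] := missS _ _ _ ab la Ee eS.
  by have [_ ->] := missS _ _ _ ab' la' Ee' eS'.
rewrite -cardM /num_leaves -/L -(cardsID M L) (setIidPr sML) addnC leq_add2l.
(* Each edge of [S] is the closed neighbourhood of a leaf outside [M], so [S] has at most as many
   members as there are such leaves. *)
rewrite -(card_imset _ val_inj).
apply: leq_trans (leq_imset_card closed_nbhd _).
apply/subset_leq_card/subsetP => _ /imsetP[e + ->]; rewrite inE.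
case/exists_inP=> a ae aLM; apply/imsetP; exists a => //.
by apply: val_leaf_edge => //; move: aLM; rewrite !inE => /andP[].
Qed.

Theorem theorem7 (T : sgraph) (hT : is_tree T) (hcard : 3 <= #|T|) :
  ((Psi (line_graph T))%:Z
   = (num_leaves T)%:Z - (num_strong_exterior_major T)%:Z)%R.
Proof.
have cL := connected_line_graph _ hT.1 hcard.
have [S0 dS0 ES0] := Psi_attained cL.
have := num_leaves_le _ _ hT hcard (resolving_pendant_cover _ _ hT hcard dS0).
have [S cS cardS] := pendant_cover_exists T.
have := Psi_min cL (pendant_cover_resolving _ _ hT cL cS).
rewrite -ES0 => leS leL; apply/eqP; rewrite eq_sym subr_eq -PoszD eqz_nat.
by rewrite eqn_leq leL (leq_trans _ cardS) ?leq_add2r.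
Qed.
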